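(* Let $(X,T)$ and $(Y,S)$ be minimal topological dynamical systems on compact metric spaces $X$ and $Y$. If $\pi:(X,T)\to(Y,S)$ is a uniformly 2-to-1 topological factor map (that is, $\pi$ is continuous, surjective, $\pi\circ T=S\circ\pi$, and $|\pi^{-1}(y)|=2$ for every $y\in Y$), then there exists $\Phi\in\operatorname{Aut}(X,T)$ with $\Phi\neq\operatorname{Id}$ and $\Phi^2=\operatorname{Id}$.
   Context: A topological dynamical system $(X,T)$ here consists of a compact metric space $X$ and a homeomorphism $T:X\to X$; it is minimal if every $T$-orbit is dense. $\operatorname{Aut}(X,T)$ is the group of homeomorphisms $\Phi:X\to X$ with $\Phi\circ T=T\circ\Phi$. *)

(* Defs.v *)
From mathcomp Require Import all_boot all_order all_algebra.
From mathcomp Require Import boolp classical_sets functions cardinality reals.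
From mathcomp Require Import topology.

Set Implicit Arguments.
Unset Strict Implicit.
Unset Printing Implicit Defensive.

Local Open Scope classical_set_scope.
Local Open Scope card_scope.

Record homeo (X Y : topologicalType) : Type := Homeo {
  homeo_fun :> X -> Y;
  homeo_inv : Y -> X;
  homeoK : cancel homeo_fun homeo_inv;
  homeo_invK : cancel homeo_inv homeo_fun;
  homeo_continuous : continuous homeo_fun;
  homeo_inv_continuous : continuous homeo_inv
}.

(* The integer power T^n; recall that Negz n is the integer -(n+1). *)
Definition homeo_iter (X : topologicalType) (T : homeo X X) (n : int) : X -> X :=
  match n with
  | Posz k => iter k T
  | Negz k => iter k.+1 (homeo_inv T)
  end.

Definition orbit (X : topologicalType) (T : homeo X X) (x : X) : set X :=
  [set homeo_iter T n x | n in [set: int]].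

Definition minimal (X : topologicalType) (T : homeo X X) : Prop :=
  forall x : X, dense (orbit T x).

Definition Aut (X : topologicalType) (T : homeo X X) : set (homeo X X) :=
  [set Phi : homeo X X | Phi \o T = T \o Phi].

Definition factor_map (X Y : topologicalType) (T : homeo X X) (S : homeo Y Y)
    (pi : X -> Y) : Prop :=
  [/\ continuous pi, set_surj [set: X] [set: Y] pi & pi \o T = S \o pi].

Definition uniformly_two_to_one (X Y : Type) (pi : X -> Y) : Prop :=
  forall y : Y, pi @^-1` [set y] #= `I_2.

(* Main.v *)
(** Let [sigma] swap the two points of each fiber of [pi].  It commutes with
[T] because [T] permutes the fibers, so only its continuity is at stake.  By
compactness every cluster point of [sigma] at [x] lies in the fiber of [x], so
[sigma] is continuous as soon as no [x] is itself such a cluster point.  The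
same remark makes the sets [n.+1^-1 <= d (x, sigma x)] closed; they cover [X],
and by Baire one of them has an interior point.  An orbit returning to that
open set carries the lower bound, through a power of [T], to a neighborhood of
any given [x]. *)
Require Import Defs.
From mathcomp Require Import all_boot all_order all_algebra.
From mathcomp Require Import boolp classical_sets functions cardinality reals.
From mathcomp Require Import topology.
From mathcomp Require Import lra.

Set Implicit Arguments.
Unset Strict Implicit.

Import Order.TTheory GRing.Theory Num.Theory.

Local Open Scope classical_set_scope.

(** If every [F n] had empty interior, one could choose nonempty open sets [V n] with the closure of
    [V n.+1] inside [V n] minus [F n]; by compactness they share a point of closure, which lies in
    no [F n]. *)
Lemma compact_baire (X : topologicalType) (F : nat -> set X) :
  hausdorff_space X -> compact [set: X] -> [set: X] !=set0 ->
  (forall n, closed (F n)) -> (forall x, exists n, F n x) ->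
  exists n, (F n)° !=set0.
Proof.
move=> hX cX X0 clF covF; apply: contrapT => /forallNP Fint0.
(* The premises sit under the existential so that [choice] yields a total function; [set0] is the
   value where they fail. *)
have step (p : nat * set X) : exists V, open p.2 -> p.2 !=set0 ->
    [/\ open V, V !=set0 & closure V `<=` p.2 `\` F p.1].
  case: p => n U /=.
  case: (pselect (open U /\ U !=set0)) => [[oU [u Uu]]|NU]; last first.
    by exists set0 => oU U0; case: NU.
  have [x [Ux Fx]] : (U `\` F n) !=set0.
    apply: contrapT => /nonemptyPn UF0; apply: (Fint0 n); exists u.
    rewrite /interior; apply: (@filterS _ _ _ U); last exact: open_nbhs_nbhs.
    move=> y Uy; apply: contrapT => Fy.
    by have : (U `\` F n) y by []; rewrite UF0.
  have nUF : nbhs x (U `\` F n).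
    apply: open_nbhs_nbhs; split=> //.
    by rewrite setDE; apply: openI => //; apply: closed_openC.
  have [W nW clW] := @compact_regular X x _ hX cX filterT _ nUF.
  exists W° => _ _; split; first exact: open_interior.
  - by exists x; apply: nbhs_singleton; apply: nbhs_interior.
  - exact: subset_trans (closureS (@interior_subset _ W)) clW.
have [f fP] := choice step.
pose V := fix V n := if n is m.+1 then f (m, V m) else setT.
have VP n : open (V n) /\ V n !=set0.
  elim: n => [|n [oV V0]] /=; first by split=> //; exact: openT.
  by case: (fP (n, V n) oV V0).
have clV n : closure (V n.+1) `<=` V n `\` F n.
  by have [oV V0] := VP n; case: (fP (n, V n) oV V0).
have Vdecr m n : (m <= n)%N -> V n `<=` V m.
  move=> /subnK <-; elim: (n - m)%N => [|k IH] //.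
  by apply: subset_trans IH; rewrite addSn => x /subset_closure/clV[].
have FP : ProperFilter (filter_from [set: nat] V).
  apply: filter_from_proper => [|n _]; last by case: (VP n).
  apply: filter_from_filter; first by exists 0%N.
  move=> m n _ _; exists (maxn m n) => // x Vx.
  by split; apply: Vdecr Vx; rewrite ?leq_maxl ?leq_maxr.
have [x [_ clx]] := cX (filter_from [set: nat] V) FP filterT.
have [n Fnx] := covF x.
suff /clV[] : closure (V n.+1) x by [].
by move=> B nB; apply: clx => //; exists n.+1.
Qed.

Definition fiber_swap (X Y : Type) (pi : X -> Y) (sigma : X -> X) : Prop :=
  forall x, [/\ sigma x <> x, pi (sigma x) = pi x
    & forall z, pi z = pi x -> z = x \/ z = sigma x].

Lemma two_to_one_fiber_swap (X Y : Type) (pi : X -> Y) :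
  uniformly_two_to_one pi -> exists sigma, fiber_swap pi sigma.
Proof.
move=> pi2; suff /choice : forall x, exists y, [/\ y <> x, pi y = pi x
    & forall z, pi z = pi x -> z = x \/ z = y] by case=> sigma; exists sigma.
move=> x.
(* Removing [a] and then [b] from the fiber leaves a set of cardinality 0. *)
have /eq_cardSP[a pa /eq_cardSP[b [pb ba]]] := pi2 (pi x).
rewrite II0 card_eq0 => /eqP Eab.
have fiber z : pi z = pi x -> z = a \/ z = b.
  move=> pz; apply: contrapT => /not_orP[za zb].
  suff : set0 z by [].
  by rewrite -Eab; split.
case: (fiber x erefl) => xE; [exists b|exists a]; split=> //; rewrite xE.
- exact: ba.
- by move=> z; rewrite -xE => /fiber[->|->]; [left|right].
- by move=> /esym.
- by move=> z; rewrite -xE => /fiber[->|->]; [right|left].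
Qed.

Section FiberSwap.
Context (X Y : Type) (pi : X -> Y) (sigma : X -> X).
Hypothesis swap : fiber_swap pi sigma.

Lemma fiber_swap_unique x z : pi z = pi x -> z <> x -> z = sigma x.
Proof. by case: (swap x) => _ _ /[apply] -[]. Qed.

Lemma fiber_swapK : involutive sigma.
Proof.
move=> x; case: (swap x) => sx psx _.
by apply/esym/fiber_swap_unique => // /esym.
Qed.

(** [f (sigma x)] lies in the fiber of [f x], and injectivity keeps it distinct from [f x]. *)
Lemma fiber_swap_comm (f : X -> X) (g : Y -> Y) :
  injective f -> pi \o f = g \o pi -> sigma \o f = f \o sigma.
Proof.
move=> finj pif; have pifE x : pi (f x) = g (pi x) := congr1 (@^~ x) pif.
apply/funext => x; case: (swap x) => sx psx _ /=.
by apply/esym/fiber_swap_unique => [|/finj//]; rewrite !pifE psx.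
Qed.

End FiberSwap.

(** Along [F], [pi \o sigma = pi] tends to [pi x] and also clusters at [pi z]; limits in [Y] are
    unique. *)
Lemma cluster_fiber (X Y : topologicalType) (pi : X -> Y) (sigma : X -> X)
    (F : set_system X) {FF : Filter F} (x z : X) :
  hausdorff_space Y -> continuous pi -> pi \o sigma = pi ->
  F --> x -> cluster (sigma @ F) z -> pi z = pi x.
Proof.
move=> hY cpi pis Fx clz; apply: hY => A B nA nB.
have FB : (sigma @ F) (pi @^-1` B).
  have -> : (sigma @ F) (pi @^-1` B) = F ((pi \o sigma) @^-1` B) by [].
  by rewrite pis; apply: Fx; apply: cpi.
by have [w [Bw Aw]] := clz _ _ FB (cpi z A nA); exists (pi w).
Qed.

Lemma fiber_swap_continuous (X Y : topologicalType) (pi : X -> Y)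
    (sigma : X -> X) :
  compact [set: X] -> hausdorff_space X -> hausdorff_space Y ->
  continuous pi -> fiber_swap pi sigma ->
  (forall x : X, exists2 W, nbhs x W & forall y, W y -> ~ W (sigma y)) ->
  continuous sigma.
Proof.
move=> cX hX hY cpi swap sep x.
have pis : pi \o sigma = pi by apply/funext => y; case: (swap y).
(* In a compact Hausdorff space a filter converges to its only cluster point. The fiber leaves [x]
   and [sigma x] as candidates, and [W] rules out [x]. *)
apply: (@compact_cluster_set1 X (sigma x) _ setT) => //; first exact: filterT.
  exact: filterT.
apply/seteqP; split=> [z clz|_ -> A B nA nB].
  apply: (fiber_swap_unique swap).
    exact: (cluster_fiber hY cpi pis cvg_id clz).
  move=> zx; have [W nW WW] := sep x.
  have nW' : nbhs x (sigma @^-1` ~` W) by apply: filterS nW => y /WW.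
  by have := clz (~` W) W nW'; rewrite zx => /(_ nW)[w []].
by exists (sigma x); split; [exact: (nbhs_singleton nA)|exact: nbhs_singleton].
Qed.

Local Open Scope ring_scope.

Lemma closed_fiber_swap_dist_ge (R : realType) (X : metricType R)
    (Y : topologicalType) (pi : X -> Y) (sigma : X -> X) (e : R) :
  compact [set: X] -> hausdorff_space Y -> continuous pi ->
  fiber_swap pi sigma -> 0 < e -> closed [set x | e <= mdist x (sigma x)].
Proof.
move=> cX hY cpi swap e0; set F := [set x | _] => p clp.
have pis : pi \o sigma = pi by apply/funext => y; case: (swap y).
pose G := within F (nbhs p).
have PG : ProperFilter G by exact: within_nbhs_proper.
have [z [_ clz]] := cX (fmap sigma G) _ filterT.
have pz : pi z = pi p.
  exact: (cluster_fiber hY cpi pis (cvg_within F) clz).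
have dz : e <= mdist p z.
  rewrite leNgt; apply/negP => pze.
  (* With [x] within [r] of [p] and [sigma x] within [r] of [z], the distance from [x] to [sigma x]
     is below [2 r + mdist p z = e]. *)
  pose r := (e - mdist p z) / 2; have r0 : 0 < r by rewrite /r; lra.
  have nA : fmap sigma G (sigma @` [set x | e <= mdist x (sigma x) /\ mdist p x < r]).
    rewrite /fmap /= /G /within /=; near=> x => Fx; exists x => //; split=> //.
    by near: x; have := nbhsx_ballx p r r0; rewrite ballEmdist.
  have nB : nbhs z [set y | mdist z y < r].
    by have := nbhsx_ballx z r r0; rewrite ballEmdist.
  have [_ [[x [ex px] <-] /= zx]] := clz _ _ nA nB.
  have := metric_triangle x p (sigma x); have := metric_triangle p z (sigma x).
  by rewrite (metric_sym x p) => ? ?; move: px zx; rewrite /r; lra.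
rewrite /F /=; suff -> : sigma p = z by [].
apply/esym/(fiber_swap_unique swap) => // zp.
by move: dz; rewrite zp mdistxx leNgt e0.
Unshelve. all: by end_near.
Qed.

Lemma homeo_iter_comm (X : topologicalType) (T : homeo X X) (f : X -> X) n :
  f \o T = T \o f -> f \o homeo_iter T n = homeo_iter T n \o f.
Proof.
have iter_comm (g : X -> X) k : f \o g = g \o f ->
    f \o iter k g = iter k g \o f.
  move=> fg; apply/funext => x /=.
  by elim: k => //= k <-; apply: (congr1 (@^~ _) fg).
move=> fT; case: n => k; first exact: iter_comm.
(* Commutation with the inverse of [T] is checked after applying [T] to both sides. *)
apply: iter_comm; apply/funext => x /=; apply: (can_inj (homeoK T)).
rewrite homeo_invK; have /= := congr1 (@^~ (homeo_inv T x)) fT.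
by rewrite homeo_invK.
Qed.

Lemma homeo_iter_continuous (X : topologicalType) (T : homeo X X) n :
  continuous (homeo_iter T n).
Proof.
have iter_continuous (g : X -> X) k : continuous g -> continuous (iter k g).
  move=> cg; elim: k => [|k IH] x; first exact: cvg_id.
  exact: (continuous_comp (IH x) (cg _)).
case: n => k; apply: iter_continuous; first exact: homeo_continuous.
exact: homeo_inv_continuous.
Qed.

Lemma minimal_separated (R : realType) (X : metricType R) (T : homeo X X)
    (sigma : X -> X) (e : R) :
  minimal T -> sigma \o T = T \o sigma -> 0 < e ->
  [set x | e <= mdist x (sigma x)]° !=set0 ->
  forall x : X, exists2 W, nbhs x W & forall y, W y -> ~ W (sigma y).
Proof.
move=> minT sT e0 U0 x.
have [u [Uu [n _ gx]]] := minT x _ U0 (@open_interior _ _).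
set g := homeo_iter T n in gx; rewrite -gx in Uu.
(* Two points of [B] are less than [e] apart, so [B] cannot contain both [g y] and
   [g (sigma y) = sigma (g y)] when [sigma] moves [g y] by at least [e]. *)
pose B := [set y | mdist (g x) y < e / 2].
have nB : nbhs (g x) B.
  by have := nbhsx_ballx (g x) (e / 2) (divr_gt0 e0 (ltr0Sn _ 1));
    rewrite ballEmdist.
exists (g @^-1` ([set y | e <= mdist y (sigma y)] `&` B)).
  exact: (@homeo_iter_continuous _ T n x _ (filterI Uu nB)).
move=> y [/= ey By] [_ /= Bsy]; move: ey.
have -> : sigma (g y) = g (sigma y) := congr1 (@^~ y) (homeo_iter_comm n sT).
have := metric_triangle (g y) (g x) (g (sigma y)).
by rewrite (metric_sym (g y) (g x)); move: By Bsy; rewrite /B /=; lra.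
Qed.

Local Close Scope ring_scope.
Unset Implicit Arguments.
Set Strict Implicit.

Theorem theorem24 (R : realType) (X Y : metricType R)
    (T : homeo X X) (S : homeo Y Y) (pi : X -> Y)
    (X_nonempty : [set: X] !=set0)
    (X_compact : compact [set: X]) (Y_compact : compact [set: Y])
    (T_minimal : minimal T) (S_minimal : minimal S)
    (pi_factor : factor_map T S pi) (pi_2to1 : uniformly_two_to_one pi) :
  exists Phi : homeo X X,
    [/\ Aut T Phi, (Phi : X -> X) <> idfun & Phi \o Phi = idfun].
Proof.
have [sigma swap] := two_to_one_fiber_swap pi_2to1.
have [cpi _ piT] := pi_factor.
have hX := @metric_hausdorff _ X; have hY := @metric_hausdorff _ Y.
have sT := fiber_swap_comm swap (can_inj (homeoK T)) piT.
have [n Fn0] : exists n : nat,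
    [set x | (n.+1%:R^-1 <= mdist x (sigma x))%R]° !=set0.
  apply: compact_baire => // [n|x].
    by apply: (closed_fiber_swap_dist_ge X_compact hY cpi swap); rewrite invr_gt0.
  have d0 : (0 < mdist x (sigma x))%R.
    by rewrite mdist_gt0; apply/eqP => /esym; case: (swap x).
  (* For [d = mdist x (sigma x)], [1/d] is below its truncation plus one; now invert. *)
  exists (Num.truncn (mdist x (sigma x))^-1)%R => /=.
  rewrite invf_ple ?posrE //; apply: ltW; exact: truncnS_gt.
have sep : forall x : X, exists2 W, nbhs x W & forall y, W y -> ~ W (sigma y).
  by apply: (minimal_separated T_minimal sT _ Fn0); rewrite invr_gt0.
have csigma := fiber_swap_continuous X_compact hX hY cpi swap sep.
have sK := fiber_swapK swap.
(* An involution is its own inverse, so one continuity proof serves both directions. *)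
exists (Homeo sK sK csigma csigma); split=> //=; last exact/funext.
have [x _] := X_nonempty; case: (swap x) => sx _ _ sid.
by apply: sx; rewrite sid.
Qed.
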